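(* Let $\alpha\in[0,1)$ and let $G$ be a strongly connected digraph with $n$ vertices, maximum outdegree $\Delta^+$ and maximum indegree $\Delta^-$. Then $$\lambda_\alpha(G)\leq \alpha\Delta^{+}+(1-\alpha)\sqrt{\Delta^{+}\Delta^{-}},$$ and equality holds if and only if $G$ is a regular digraph.
   Context: Digraphs are finite, have no loops and no two arcs with the same tail and the same head (pairs of opposite arcs $(v_i,v_j),(v_j,v_i)$ are allowed). For a digraph $G$ with vertices $v_1,\dots,v_n$, $A(G)=(a_{ij})$ is the adjacency matrix ($a_{ij}=1$ if $(v_i,v_j)$ is an arc, $0$ otherwise), $d_i^+$ is the outdegree of $v_i$ (number of arcs with tail $v_i$), $d_i^-$ its indegree, and $D(G)=\mathrm{diag}(d_1^+,\dots,d_n^+)$. The $A_\alpha$ matrix is $A_\alpha(G)=\alpha D(G)+(1-\alpha)A(G)$, and $\lambda_\alpha(G)$ denotes the eigenvalue of $A_\alpha(G)$ of largest modulus (for strongly connected $G$ this is the Perron root of $A_\alpha(G)$). A digraph is strongly connected if there is a directed path from every vertex to every other vertex. A digraph is regular if, for some $k$, every vertex has outdegree $k$ and indegree $k$. *)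

(* Defs.v *)
From HB Require Import structures.
From mathcomp Require Import all_boot all_order all_algebra.
From mathcomp Require Import complex.
From mathcomp Require Import boolp classical_sets reals.

Set Implicit Arguments.
Unset Strict Implicit.
Unset Printing Implicit Defensive.

Import Order.TTheory GRing.Theory Num.Theory.

Local Open Scope ring_scope.
Local Open Scope complex_scope.

Record digraph (n : nat) := Digraph {
  arc :> rel 'I_n;
  arc_irrefl : irreflexive arc
}.

Section DigraphDefs.
Variables (n : nat) (G : digraph n).

Definition outdeg (i : 'I_n) : nat := #|[set j | G i j]%SET|.
Definition indeg (i : 'I_n) : nat := #|[set j | G j i]%SET|.

Definition max_outdeg : nat := (\max_(i < n) outdeg i)%N.
Definition max_indeg : nat := (\max_(i < n) indeg i)%N.

Definition strongly_connected : Prop := forall u v : 'I_n, connect G u v.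

Definition regular_digraph : Prop :=
  exists k : nat, forall i : 'I_n, outdeg i = k /\ indeg i = k.

End DigraphDefs.

Section AlphaMatrix.
Variables (R : realType) (n : nat).

Definition adj_mx (G : digraph n) : 'M[R]_n := \matrix_(i, j) (G i j)%:R.

Definition outdeg_mx (G : digraph n) : 'M[R]_n :=
  diag_mx (\row_i (outdeg G i)%:R).

Definition A_alpha (alpha : R) (G : digraph n) : 'M[R]_n :=
  alpha *: outdeg_mx G + (1 - alpha) *: adj_mx G.

Definition complex_eigenvalue (A : 'M[R]_n) (mu : R[i]) : Prop :=
  eigenvalue (map_mx (real_complex R) A) mu.

(* Several complex eigenvalues may share the largest modulus (e.g. the
   adjacency matrix of a directed cycle); "the" eigenvalue of largest modulus
   is then the one that is a nonnegative real number. *)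
Definition is_largest_modulus_eigenvalue (A : 'M[R]_n) (l : R) : Prop :=
  [/\ 0 <= l, complex_eigenvalue A l%:C
    & forall mu : R[i], complex_eigenvalue A mu -> `|mu| <= l%:C].

(* Such an l is unique, and by Perron-Frobenius it exists as soon as n > 0 and
   A has nonnegative entries, so the default value 0 is then not used. *)
Definition perron_root (A : 'M[R]_n) : R :=
  xget 0 [set l : R | is_largest_modulus_eigenvalue A l]%classic.

Definition lambda_alpha (alpha : R) (G : digraph n) : R :=
  perron_root (A_alpha alpha G).

End AlphaMatrix.

(* Main.v *)
Require Import Defs.
From HB Require Import structures.
From mathcomp Require Import all_boot all_order all_algebra.
From mathcomp Require Import complex.
From mathcomp Require Import boolp classical_sets reals.
From mathcomp Require Import ring.

(* For a real eigenvector [x] of [A_alpha] with eigenvalue [l], the identity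
   [l |x|^2 = alpha sum_i d_i^+ x_i^2 + (1 - alpha) sum_(i -> j) x_i x_j]
   reduces the bound to AM-GM on each arc,
   [2 sqrt (D+ D-) x_i x_j <= D- x_i^2 + D+ x_j^2]. In case of equality,
   [sqrt D- x_i = sqrt D+ x_j] along every arc, so by strong connectivity [x]
   vanishes nowhere and every vertex has outdegree [D+] and indegree [D-], which
   agree by counting arcs. The existence part of Perron-Frobenius is not needed:
   when [perron_root] falls back to its default [0], the bound is trivial and
   strict as soon as there is an arc, and for a [k]-regular digraph [k] is
   exhibited as the largest eigenvalue directly. *)

Set Implicit Arguments.
Unset Strict Implicit.
Unset Printing Implicit Defensive.

Import Order.TTheory GRing.Theory Num.Theory.

Local Open Scope ring_scope.
Local Open Scope complex_scope.

(** * Degree counts and propagation along arcs *)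

Section Degrees.
Variables (n : nat) (G : digraph n).

Lemma outdeg_sum i : outdeg G i = (\sum_j G i j)%N.
Proof.
rewrite /outdeg -sum1_card big_mkcond /=.
by apply: eq_bigr => j _; rewrite inE; case: (G i j).
Qed.

Lemma indeg_sum i : indeg G i = (\sum_j G j i)%N.
Proof.
rewrite /indeg -sum1_card big_mkcond /=.
by apply: eq_bigr => j _; rewrite inE; case: (G j i).
Qed.

Lemma outdeg_le_max i : (outdeg G i <= max_outdeg G)%N.
Proof. exact: leq_bigmax. Qed.

Lemma indeg_le_max i : (indeg G i <= max_indeg G)%N.
Proof. exact: leq_bigmax. Qed.

Lemma arc_outdeg_gt0 i j : G i j -> (0 < outdeg G i)%N.
Proof.
by move=> Gij; rewrite card_gt0; apply/set0Pn; exists j; rewrite inE.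
Qed.

Lemma arc_indeg_gt0 i j : G i j -> (0 < indeg G j)%N.
Proof.
by move=> Gij; rewrite card_gt0; apply/set0Pn; exists i; rewrite inE.
Qed.

Lemma sum_outdeg_indeg : (\sum_i outdeg G i = \sum_i indeg G i)%N.
Proof.
under eq_bigr do rewrite outdeg_sum.
under [RHS]eq_bigr do rewrite indeg_sum.
exact: exchange_big.
Qed.

(* Counting the arcs by tail and by head forces the two degrees to agree. *)
Lemma const_degrees_regular (p q : nat) : (0 < n)%N ->
  (forall i, outdeg G i = p) -> (forall i, indeg G i = q) -> regular_digraph G.
Proof.
move=> n_gt0 outp inq; exists p => i; split=> //.
have := sum_outdeg_indeg; under eq_bigr do rewrite outp.
under [RHS]eq_bigr do rewrite inq.
by rewrite !sum_nat_const card_ord => /eqP; rewrite eqn_pmul2l // => /eqP ->.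
Qed.

Lemma regular_max_degrees k : (0 < n)%N ->
  (forall i, outdeg G i = k /\ indeg G i = k) ->
  max_outdeg G = k /\ max_indeg G = k.
Proof.
case: n G => // m H _ regk.
split; apply/eqP; rewrite eqn_leq; apply/andP; split.
- by apply/bigmax_leqP => i _; rewrite (regk i).1.
- by rewrite -[X in (X <= _)%N](regk ord0).1; exact: leq_bigmax.
- by apply/bigmax_leqP => i _; rewrite (regk i).2.
- by rewrite -[X in (X <= _)%N](regk ord0).2; exact: leq_bigmax.
Qed.

(** Induction along a directed path from [u]; it later spreads the nonvanishing of an eigenvector
    from one entry to all. *)
Lemma connected_support (P : pred 'I_n) u : strongly_connected G ->
  (forall i j, G i j -> P i -> P j) -> P u -> forall v, P v.
Proof.
move=> scG stepP Pu v; have /connectP[w] := scG u v.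
elim: w u Pu => [|x w IHw] u Pu /=; first by move=> _ ->.
by case/andP=> Gux; apply: IHw; exact: stepP Gux Pu.
Qed.

End Degrees.

(** * The largest-modulus eigenvalue *)

Section PerronRoot.
Variables (R : realType) (n : nat).
Implicit Types (A : 'M[R]_n) (l : R).

(** The embedding of the reals preserves and reflects roots of the characteristic polynomial; this
    provides a real eigenvector. *)
Lemma real_complex_eigenvalue A l : complex_eigenvalue A l%:C -> eigenvalue A l.
Proof.
by rewrite /complex_eigenvalue !eigenvalue_root_char -map_char_poly fmorph_root.
Qed.

Lemma perron_root_unique A l :
  is_largest_modulus_eigenvalue A l -> perron_root A = l.
Proof.
move=> [l0 le lmax]; have [r0 re rmax] :
    is_largest_modulus_eigenvalue A (perron_root A).
  by apply: (@xgetPex _ _ [set l | is_largest_modulus_eigenvalue A l]%classic);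
     exists l.
apply/le_anti/andP; split; rewrite -lecR.
- by have := lmax _ re; rewrite ger0_norm ?lecR.
- by have := rmax _ le; rewrite ger0_norm ?lecR.
Qed.

(** A nonzero value cannot be the default of [xget], so it satisfies the defining predicate. *)
Lemma perron_root_eigenvalue A :
  perron_root A != 0 -> eigenvalue A (perron_root A).
Proof.
rewrite /perron_root; case: xgetP => [l _ [_ /real_complex_eigenvalue //]|_].
by rewrite eqxx.
Qed.

(** Eigenvectors are row vectors here: take moduli in [mu * v_j = \sum_i v_i A_ij] and sum over [j],
    so that each [|v_i|] is weighted by the sum of row [i]. *)
Lemma row_sum_eigenvalue_bound A k (mu : R[i]) :
  (forall i j, 0 <= A i j) -> (forall i, \sum_j A i j = k) ->
  complex_eigenvalue A mu -> `|mu| <= k%:C.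
Proof.
move=> A0 Ak /eigenvalueP[v vA v0].
have S_gt0 : 0 < \sum_j `|v 0 j|.
  rewrite lt0r sumr_ge0 ?andbT//; apply: contra_neq v0 => /eqP.
  rewrite psumr_eq0// => /allP v0; apply/rowP => j; rewrite mxE.
  by apply/eqP; rewrite -normr_eq0; apply: (implyP (v0 j (mem_index_enum _))).
rewrite -(ler_pM2r S_gt0) mulr_sumr.
have -> : k%:C * (\sum_j `|v 0 j|) = \sum_j \sum_i `|v 0 i| * (A i j)%:C.
  rewrite exchange_big mulr_sumr; apply: eq_bigr => i _ /=.
  by rewrite -mulr_sumr -rmorph_sum Ak mulrC.
apply: ler_sum => j _; rewrite -normrM.
have -> : mu * v 0 j = \sum_i v 0 i * (A i j)%:C.
  move/rowP/(_ j): vA; rewrite !mxE => <-.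
  by apply: eq_bigr => i _; rewrite mxE.
apply: le_trans (ler_norm_sum _ _ _) _; apply: ler_sum => i _.
by rewrite normrM [`|_%:C|]ger0_norm // lecR.
Qed.

End PerronRoot.

(** * Eigenvalues of the alpha matrix *)

Section AlphaSpectrum.
Variables (R : realType) (alpha : R) (n : nat) (G : digraph n).

Lemma A_alphaE i j : A_alpha alpha G i j =
  alpha * ((outdeg G i)%:R *+ (i == j)) + (1 - alpha) * (G i j)%:R.
Proof. by rewrite !mxE. Qed.

Lemma A_alpha_row_sum i : \sum_j A_alpha alpha G i j = (outdeg G i)%:R.
Proof.
under eq_bigr do rewrite A_alphaE.
rewrite big_split /= -!mulr_sumr -natr_sum -outdeg_sum (bigD1 i)//= eqxx mulr1n.
rewrite big1 ?addr0 => [|j /negbTE]; last by rewrite eq_sym => ->.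
by rewrite -mulrDl addrC subrK mul1r.
Qed.

Lemma mul_row_A_alpha (x : 'rV[R]_n) j : (x *m A_alpha alpha G) 0 j =
  alpha * (outdeg G j)%:R * x 0 j + (1 - alpha) * \sum_i (G i j)%:R * x 0 i.
Proof.
rewrite mxE; under eq_bigr do rewrite A_alphaE mulrDr.
rewrite big_split /= mulr_sumr (bigD1 j)//= eqxx mulr1n big1 ?addr0.
  rewrite mulrC; congr (_ + _); apply: eq_bigr => i _.
  by rewrite mulrCA [x 0 i * _]mulrC.
by move=> i /negbTE->; rewrite mulr0n mulr0 mulr0.
Qed.

(** The all-ones row vector is an eigenvector because the column sums, which involve the indegrees,
    equal [k]; the modulus bound comes from the row sums, which are the outdegrees. *)
Lemma regular_lambda_alpha k : 0 <= alpha < 1 -> (0 < n)%N ->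
  (forall i, outdeg G i = k /\ indeg G i = k) -> lambda_alpha alpha G = k%:R.
Proof.
move=> /andP[a0 a1] n_gt0 regk; apply: perron_root_unique; split=> [||mu].
- exact: ler0n.
- have xA : const_mx 1 *m A_alpha alpha G = k%:R *: const_mx 1 :> 'rV[R]_n.
    apply/rowP => j; rewrite mul_row_A_alpha !mxE (regk j).1.
    under eq_bigr do rewrite mxE mulr1.
    by rewrite -natr_sum -indeg_sum (regk j).2 !mulr1 -mulrDl addrC subrK mul1r.
  apply/eigenvalueP; exists (map_mx (real_complex R) (const_mx 1)).
    by rewrite -map_mxM xA map_mxZ.
  rewrite map_mx_eq0; apply/eqP => /rowP/(_ (Ordinal n_gt0)) /eqP.
  by rewrite !mxE oner_eq0.
- apply: row_sum_eigenvalue_bound => [i j|i].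
    rewrite A_alphaE addr_ge0 ?mulr_ge0 ?mulrn_wge0 ?ler0n//.
    by rewrite subr_ge0 ltW.
  by rewrite A_alpha_row_sum (regk i).1.
Qed.

(* The excess of the bound over the eigenvalue as a sum of nonnegative terms,
   for [a] and [b] the square roots of the maximum out- and indegree. *)
Lemma A_alpha_eigenvector_slack (l a b : R) (x : 'rV[R]_n) :
  x *m A_alpha alpha G = l *: x ->
  2 * (a * b) * (alpha * a ^+ 2 + (1 - alpha) * (a * b) - l) *
    \sum_i x 0 i ^+ 2 =
  2 * (a * b) * alpha * (\sum_i (a ^+ 2 - (outdeg G i)%:R) * x 0 i ^+ 2) +
  (1 - alpha) *
    ((\sum_i \sum_j (G i j)%:R * (b * x 0 i - a * x 0 j) ^+ 2) +
     b ^+ 2 * (\sum_i (a ^+ 2 - (outdeg G i)%:R) * x 0 i ^+ 2) +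
     a ^+ 2 * (\sum_i (b ^+ 2 - (indeg G i)%:R) * x 0 i ^+ 2)).
Proof.
move=> xA.
pose S := \sum_i x 0 i ^+ 2.
pose O := \sum_i (outdeg G i)%:R * x 0 i ^+ 2.
pose I := \sum_i (indeg G i)%:R * x 0 i ^+ 2.
pose E := \sum_i \sum_j (G i j)%:R * (x 0 i * x 0 j).
(* Pair the eigenvector equation with [x] itself. *)
have lS : l * S = alpha * O + (1 - alpha) * E.
  rewrite /E exchange_big !mulr_sumr -big_split; apply: eq_bigr => j _ /=.
  have := congr1 (fun y : 'rV_n => y 0 j * x 0 j) xA.
  rewrite mul_row_A_alpha !mxE expr2 mulrA => <-.
  rewrite mulrDl -!mulrA; congr (_ + _ * _); rewrite mulr_suml.
  by apply: eq_bigr => i _; rewrite mulrA.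
have degS c (d : 'I_n -> nat) : \sum_i (c - (d i)%:R) * x 0 i ^+ 2 =
    c * S - \sum_i (d i)%:R * x 0 i ^+ 2.
  by rewrite mulr_sumr -sumrB; apply: eq_bigr => i _; rewrite mulrBl.
(* Expand the square: summing over heads turns [x_i ^+ 2] into an outdegree term, summing over tails
   turns [x_j ^+ 2] into an indegree term. *)
have -> : \sum_i \sum_j (G i j)%:R * (b * x 0 i - a * x 0 j) ^+ 2 =
    b ^+ 2 * O - 2 * (a * b) * E + a ^+ 2 * I.
  have -> : O = \sum_i \sum_j (G i j)%:R * x 0 i ^+ 2.
    by apply: eq_bigr => i _; rewrite outdeg_sum natr_sum mulr_suml.
  have -> : I = \sum_i \sum_j (G i j)%:R * x 0 j ^+ 2.
    rewrite exchange_big; apply: eq_bigr => i _.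
    by rewrite indeg_sum natr_sum mulr_suml.
  rewrite !mulr_sumr -sumrB -big_split; apply: eq_bigr => i _ /=.
  rewrite !mulr_sumr -sumrB -big_split; apply: eq_bigr => j _ /=.
  by ring.
rewrite !degS -/S -/O -/I.
rewrite mulrBr mulrBl -[_ * l * S]mulrA lS.
by move: S O I E {lS degS} => S O I E; ring.
Qed.

Hypothesis halpha : 0 <= alpha < 1.

Let p : R := (max_outdeg G)%:R.
Let q : R := (max_indeg G)%:R.
Let bound : R := alpha * p + (1 - alpha) * Num.sqrt (p * q).

Lemma alpha_bound_gt0 : 0 < p -> 0 < q -> 0 < bound.
Proof.
case/andP: halpha => a0 a1 p0 q0.
by rewrite ltr_wpDl ?mulr_ge0 ?mulr_gt0 ?sqrtr_gt0 ?mulr_gt0 ?subr_gt0// ltW.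
Qed.

Lemma A_alpha_eigenvalue_bound (l : R) : 0 < p -> 0 < q ->
  eigenvalue (A_alpha alpha G) l ->
  l <= bound /\
  (l = bound -> strongly_connected G ->
   forall i, outdeg G i = max_outdeg G /\ indeg G i = max_indeg G).
Proof.
move=> p0 q0 /eigenvalueP[x xA xn0]; case/andP: halpha => a0 a1.
have sa0 : 0 < 1 - alpha by rewrite subr_gt0.
have := A_alpha_eigenvector_slack (Num.sqrt p) (Num.sqrt q) xA.
set a := Num.sqrt p; set b := Num.sqrt q.
have ap : 0 < a by rewrite sqrtr_gt0.
have bp : 0 < b by rewrite sqrtr_gt0.
have -> : a * b = Num.sqrt (p * q) by rewrite sqrtrM ?ler0n.
rewrite (sqr_sqrtr (ltW p0)) (sqr_sqrtr (ltW q0)) -/bound.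
set r := Num.sqrt _; have rp : 0 < r by rewrite sqrtr_gt0 mulr_gt0.
set S := \sum_i x 0 i ^+ 2; set T := \sum_i \sum_j _.
set U := \sum_i (p - _) * _; set V := \sum_i (q - _) * _ => slack.
have S0 : 0 < S.
  rewrite lt0r sumr_ge0 => [|i _]; last exact: sqr_ge0.
  rewrite andbT; apply: contra_neq xn0 => /eqP.
  rewrite psumr_eq0 => [/allP h|i _]; last exact: sqr_ge0.
  apply/rowP => j; rewrite mxE; apply/eqP; rewrite -sqrf_eq0.
  exact: (implyP (h j (mem_index_enum _))).
have Tij i j : 0 <= (G i j)%:R * (b * x 0 i - a * x 0 j) ^+ 2.
  by rewrite mulr_ge0 ?sqr_ge0.
have Ui i : 0 <= (p - (outdeg G i)%:R) * x 0 i ^+ 2.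
  by rewrite mulr_ge0 ?sqr_ge0 ?subr_ge0 ?ler_nat ?outdeg_le_max.
have Vi i : 0 <= (q - (indeg G i)%:R) * x 0 i ^+ 2.
  by rewrite mulr_ge0 ?sqr_ge0 ?subr_ge0 ?ler_nat ?indeg_le_max.
have T0 : 0 <= T by rewrite sumr_ge0// => i _; rewrite sumr_ge0.
have U0 : 0 <= U by rewrite sumr_ge0.
have V0 : 0 <= V by rewrite sumr_ge0.
have W0 : 0 <= T + q * U + p * V by rewrite !addr_ge0 ?mulr_ge0 ?ler0n.
have Z0 : 0 <= 2 * r * alpha * U by rewrite !mulr_ge0 ?ler0n ?(ltW rp).
split=> [|l_bound scG].
  (* The factors [2 * r] and [S] are positive, so [bound - l] has the sign of the right-hand side of
     [slack]. *)
  rewrite -subr_ge0 -(pmulr_rge0 _ (mulr_gt0 (ltr0Sn R 1) rp)).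
  by rewrite -(pmulr_lge0 _ S0) slack (addr_ge0 Z0)// mulr_ge0 ?(ltW sa0).
(* At equality every nonnegative summand vanishes. The one with factor [alpha] is dropped, as
   [alpha] may be 0; the positive factors [1 - alpha], [p] and [q] leave [T = U = V = 0]. *)
move/eqP: slack; rewrite l_bound subrr mulr0 mul0r eq_sym.
rewrite (paddr_eq0 Z0) ?(mulr_ge0 (ltW sa0) W0)//.
rewrite [_ * (_ + _) == 0]mulf_eq0 (gt_eqF sa0) /=.
rewrite paddr_eq0 ?addr_ge0 ?mulr_ge0 ?ler0n// paddr_eq0 ?mulr_ge0 ?ler0n//.
rewrite !mulf_eq0 (gt_eqF p0) (gt_eqF q0) /=.
case/andP=> _ /andP[/andP[/eqP T_eq0 /eqP U_eq0] /eqP V_eq0].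
(* Since [T = 0], [b * x_i = a * x_j] on each arc; with [b] positive, a zero at the head forces a
   zero at the tail. *)
have xprop i j : G i j -> x 0 i != 0 -> x 0 j != 0.
  move=> Gij; apply: contra_neq => xj0.
  have Ti0 := psumr_eq0P (fun i _ => sumr_ge0 _ (fun j _ => Tij i j)) T_eq0.
  have := psumr_eq0P (fun j _ => Tij i j) (Ti0 i isT) (i := j) isT.
  rewrite Gij mul1r xj0 mulr0 subr0 => /eqP.
  by rewrite sqrf_eq0 mulf_eq0 (gt_eqF bp) => /eqP.
have /rV0Pn[u xu] := xn0.
have x_neq0 := connected_support (P := fun i => x 0 i != 0) scG xprop xu.
move=> i; split; apply/esym/eqP.
- have /eqP := psumr_eq0P (fun i _ => Ui i) U_eq0 (i := i) isT.
  by rewrite mulf_eq0 sqrf_eq0 (negbTE (x_neq0 i)) orbF subr_eq0 eqr_nat.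
- have /eqP := psumr_eq0P (fun i _ => Vi i) V_eq0 (i := i) isT.
  by rewrite mulf_eq0 sqrf_eq0 (negbTE (x_neq0 i)) orbF subr_eq0 eqr_nat.
Qed.

End AlphaSpectrum.

Theorem theorem2p2 (R : realType) (alpha : R) (n : nat) (G : digraph n)
    (halpha : 0 <= alpha < 1) (hn : (0 < n)%N) (hG : strongly_connected G) :
  let bound : R :=
    alpha * (max_outdeg G)%:R
    + (1 - alpha) * Num.sqrt ((max_outdeg G)%:R * (max_indeg G)%:R) in
  lambda_alpha alpha G <= bound /\
  (lambda_alpha alpha G = bound <-> regular_digraph G).
Proof.
move=> bound.
have regular_eq : regular_digraph G -> lambda_alpha alpha G = bound.
  case=> k regk; rewrite (regular_lambda_alpha halpha hn regk) /bound.
  have [-> ->] := regular_max_degrees hn regk.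
  by rewrite -expr2 sqrtr_sqr ger0_norm// -mulrDl addrC subrK mul1r.
have [/existsP[i /existsP[j Gij]]|noarc] := boolP [exists i, exists j, G i j].
  have p0 : 0 < (max_outdeg G)%:R :> R.
    by rewrite ltr0n (leq_trans (arc_outdeg_gt0 Gij))// outdeg_le_max.
  have q0 : 0 < (max_indeg G)%:R :> R.
    by rewrite ltr0n (leq_trans (arc_indeg_gt0 Gij))// indeg_le_max.
  have bound0 : 0 < bound by exact: alpha_bound_gt0.
  (* The value 0, default or genuine, lies strictly below the positive bound, so equality is
     impossible here. *)
  have [l0|] := eqVneq (lambda_alpha alpha G) 0.
    split; first by rewrite l0 ltW.
    by split=> // lb; move: bound0; rewrite -lb l0 ltxx.
  move/perron_root_eigenvalue/(A_alpha_eigenvalue_bound halpha p0 q0).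
  move=> [le_bound eq_bound]; split=> //; split=> // /eq_bound/(_ hG) degs.
  apply: (const_degrees_regular (p := max_outdeg G) (q := max_indeg G) hn) => v.
    exact: (degs v).1.
  exact: (degs v).2.
(* Without arcs the digraph is 0-regular, and the regular case gives equality. *)
have reg0 : regular_digraph G.
  exists 0%N => i; split; apply/eqP; rewrite cards_eq0; apply/eqP/setP => j.
    rewrite !inE; apply: contraNF noarc => Gij.
    by apply/existsP; exists i; apply/existsP; exists j.
  rewrite !inE; apply: contraNF noarc => Gji.
  by apply/existsP; exists j; apply/existsP; exists i.
by split; [rewrite regular_eq|].
Qed.
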